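(* Let $\{\tilde x_k\}$, $\{u_k\}$, $\{\varepsilon_k\}$ be generated by Algorithm 2 (the inexact partial inverse method for $(T,V)$ described in the context, with starting point $x_0$ and parameter $\sigma\in[0,1[$). Let the ergodic sequences be $$\tilde x_k^a:=\frac1k\sum_{\ell=1}^k\tilde x_\ell,\quad u_k^a:=\frac1k\sum_{\ell=1}^k u_\ell,\quad \varepsilon_k^a:=\frac1k\sum_{\ell=1}^k\big[\varepsilon_\ell+\langle \tilde x_\ell-\tilde x_k^a,\,u_\ell-u_k^a\rangle\big],$$ and let $d_{0,V}$ be the distance of $x_0$ to $\mathcal S^*(V,T)$. Then: (a) For any $k\ge1$ there exists $j\in\{1,\dots,k\}$ such that $$u_j\in T^{\varepsilon_j}(\tilde x_j),\quad \sqrt{\|\tilde x_j-P_V(\tilde x_j)\|^2+\|u_j-P_{V^\perp}(u_j)\|^2}\le \frac{d_{0,V}}{\sqrt k}\sqrt{\frac{1+\sigma}{1-\sigma}},\quad \varepsilon_j\le\frac{\sigma^2d_{0,V}^2}{2(1-\sigma^2)k}.$$ (b) For any $k\ge1$, $$u_k^a\in T^{\varepsilon_k^a}(\tilde x_k^a),\quad \sqrt{\|\tilde x_k^a-P_V(\tilde x_k^a)\|^2+\|u_k^a-P_{V^\perp}(u_k^a)\|^2}\le\frac{2d_{0,V}}{k},\quad 0\le\varepsilon_k^a\le\frac{2(1+\sigma/\sqrt{1-\sigma^2})\,d_{0,V}^2}{k}.$$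
   Context: $\mathcal H$ is a real Hilbert space, $T:\mathcal H\rightrightarrows\mathcal H$ is maximal monotone, $V\subseteq\mathcal H$ is a closed subspace, and $P_V,P_{V^\perp}$ are the orthogonal projections onto $V$ and its orthogonal complement $V^\perp$. For $\varepsilon\ge0$ the $\varepsilon$-enlargement of $T$ is $T^\varepsilon(x):=\{v\in\mathcal H:\langle v'-v,x'-x\rangle\ge-\varepsilon\ \ \forall (x',v')\text{ with }v'\in T(x')\}$. The problem is to find $x\in V$, $u\in V^\perp$ with $u\in T(x)$; its solution set is $\mathcal S^*(V,T):=\{z\in\mathcal H:\ z=x+u \text{ for some } x\in V,\ u\in V^\perp \text{ with } u\in T(x)\}$, assumed nonempty. Algorithm 2: given $x_0\in\mathcal H$ and $\sigma\in[0,1[$, for $k=1,2,\dots$ choose any $(\tilde x_k,u_k,\varepsilon_k)\in\mathcal H\times\mathcal H\times\mathbb R_+$ such that $$u_k\in T^{\varepsilon_k}(\tilde x_k),\qquad \|u_k+\tilde x_k-x_{k-1}\|^2+2\varepsilon_k\le\sigma^2\|P_V(\tilde x_k)+P_{V^\perp}(u_k)-x_{k-1}\|^2,$$ and set $x_k=x_{k-1}-[P_V(u_k)+P_{V^\perp}(\tilde x_k)]$. *)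

(* Defs.v *)
From HB Require Import structures.
From mathcomp Require Import all_boot all_order all_algebra.
From mathcomp Require Import all_classical all_reals all_analysis.
Import Order.TTheory GRing.Theory Num.Theory.
Import numFieldNormedType.Exports.

Set Implicit Arguments.
Unset Strict Implicit.
Unset Printing Implicit Defensive.

Local Open Scope classical_set_scope.
Local Open Scope ring_scope.

(* A real Hilbert space is a complete normed module over the reals together with
   a positive definite symmetric bilinear form that induces its norm. *)
Definition induces_norm (R : realType) (H : completeNormedModType R)
    (dot : {dot H for (@idfun R)}) : Prop :=
  forall x : H, `|x| = Num.sqrt (dot x x).

Definition closed_subspace (R : realType) (H : completeNormedModType R)
    (V : set H) : Prop :=
  GRing.submod_closed [in V] /\ closed V.

Definition orth_compl (R : realType) (H : completeNormedModType R)
    (dot : {dot H for (@idfun R)}) (V : set H) : set H :=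
  [set y | forall v, V v -> dot v y = 0].

(* The default value 0 is irrelevant for a closed subspace V of a Hilbert space,
   where there is exactly one such p. *)
Definition orth_proj (R : realType) (H : completeNormedModType R)
    (dot : {dot H for (@idfun R)}) (V : set H) (x : H) : H :=
  xget 0 [set p | V p /\ orth_compl dot V (x - p)].

(* Set-valued operators on H are functions H -> set H. *)
Definition graph (R : realType) (H : completeNormedModType R)
    (T : H -> set H) : set (H * H) :=
  [set xv | T xv.1 xv.2].

Definition monotone_op (R : realType) (H : completeNormedModType R)
    (dot : {dot H for (@idfun R)}) (T : H -> set H) : Prop :=
  forall x x' v v', T x v -> T x' v' -> 0 <= dot (v' - v) (x' - x).

Definition maximal_monotone (R : realType) (H : completeNormedModType R)
    (dot : {dot H for (@idfun R)}) (T : H -> set H) : Prop :=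
  monotone_op dot T /\
  forall S : H -> set H, monotone_op dot S ->
    graph T `<=` graph S -> graph S = graph T.

Definition enlargement (R : realType) (H : completeNormedModType R)
    (dot : {dot H for (@idfun R)}) (T : H -> set H) (e : R) (x : H) : set H :=
  [set v | forall x' v', T x' v' -> - e <= dot (v' - v) (x' - x)].

Definition solution_set (R : realType) (H : completeNormedModType R)
    (dot : {dot H for (@idfun R)}) (V : set H) (T : H -> set H) : set H :=
  [set z | exists x u,
    [/\ V x, orth_compl dot V u, T x u & z = x + u]].

Definition dist_to (R : realType) (H : completeNormedModType R)
    (x : H) (S : set H) : R :=
  inf [set `|x - z| | z in S].

(* The entries xt 0, u 0 and eps 0 are not constrained. *)
Definition inexact_partial_inverse (R : realType) (H : completeNormedModType R)
    (dot : {dot H for (@idfun R)}) (V : set H) (T : H -> set H)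
    (x0 : H) (sigma : R) (x xt u : nat -> H) (eps : nat -> R) : Prop :=
  let P := orth_proj dot V in
  let Q := orth_proj dot (orth_compl dot V) in
  x 0%N = x0 /\
  forall k : nat, (1 <= k)%N ->
    [/\ 0 <= eps k,
        enlargement dot T (eps k) (xt k) (u k),
        `|u k + xt k - x k.-1| ^+ 2 + 2 * eps k
          <= sigma ^+ 2 * `|P (xt k) + Q (u k) - x k.-1| ^+ 2
      & x k = x k.-1 - (P (u k) + Q (xt k))].

Definition ergodic_mean (R : realType) (H : completeNormedModType R)
    (w : nat -> H) (k : nat) : H :=
  k%:R^-1 *: \sum_(1 <= l < k.+1) w l.

Definition ergodic_eps (R : realType) (H : completeNormedModType R)
    (dot : {dot H for (@idfun R)})
    (xt u : nat -> H) (eps : nat -> R) (k : nat) : R :=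
  k%:R^-1 * \sum_(1 <= l < k.+1)
    (eps l + dot (xt l - ergodic_mean xt k) (u l - ergodic_mean u k)).

(* Main.v *)
Require Import Defs.
From HB Require Import structures.
From mathcomp Require Import all_boot all_order all_algebra.
From mathcomp Require Import all_classical all_reals all_analysis.
From mathcomp Require Import ring lra.
Import Order.TTheory GRing.Theory Num.Theory.
Import numFieldNormedType.Exports.

Local Open Scope classical_set_scope.
Local Open Scope ring_scope.

(** The method is a hybrid proximal extragradient (HPE) iteration in disguise.
    Write P for the projection onto V.  The map
    (a, b) |-> (P a + (b - P b), P b + (a - P a)), which exchanges the
    V^perp-components of a and b, preserves the pairing <a, b>
    ([dot_partial_swap]); it turns T into Spingarn's partial inverse T_V, again
    monotone, whose zeros are exactly the solutions x + u.  If (w_k, v_k) is the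
    image of (xt_k, u_k), then v_k + w_k = u_k + xt_k, so the error criterion
    reads |v_k + w_k - x_{k-1}|^2 + 2 eps_k <= sigma^2 |w_k - x_{k-1}|^2 and
    the update reads x_k = x_{k-1} - v_k: this is an HPE iteration for T_V with
    unit stepsize.  Moreover both residuals in the statement are norms of v,
    since |a - P a|^2 + |P b|^2 = |P b + (a - P a)|^2.

    For an HPE iteration, one algebraic identity gives ([hpe_step]), for every
    point z,
      2 (eps_k + <w_k - z, v_k>) + (1 - sigma^2) |w_k - x_{k-1}|^2
        <= |x_{k-1} - z|^2 - |x_k - z|^2,
    and the right-hand side telescopes.  At a zero z the first term is
    nonnegative, so (1 - sigma^2) times the sum of the |w_l - x_{l-1}|^2 is at
    most |x_0 - z|^2; the index with the smallest term yields the pointwise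
    bounds, because |v_l| <= (1 + sigma) |w_l - x_{l-1}| and
    2 eps_l <= sigma^2 |w_l - x_{l-1}|^2.  It also follows that |x_k - z| is
    nonincreasing, and as the mean of the v_l is (x_0 - x_k) / k, its norm is at
    most 2 |x_0 - z| / k.

    With z the mean of the w_l, the sum of the first terms is 2 k eps^a_k
    ([ergodic_epsE]), whence 2 k eps^a_k <= |x_0 - z|^2 - |x_k - z|^2
    ([hpe_ergodic_eps_le] bounds the difference).  The inclusion of the means in
    the enlargement of T is the transportation formula ([enlargement_ergodic]),
    and eps^a_k >= 0 because a maximal monotone operator has no enlargement of
    negative parameter ([enlargement_ge0]).

    Every estimate is proved for an arbitrary zero z, and only then is the
    infimum over z taken ([le_sqr_dist_to]); no zero nearest to x_0 has to be
    produced. *)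

(** * Inner product identities *)

Section InnerProduct.
Context {R : realType} {H : completeNormedModType R}.
Context {dot : {dot H for (@idfun R)}}.

Lemma dotC (a b : H) : dot a b = dot b a.
Proof. by have := hermC dot a b; rewrite expr0 mul1r. Qed.

Lemma dotDl (a b c : H) : dot (a + b) c = dot a c + dot b c.
Proof. exact: linearDl. Qed.

Lemma dotDr (a b c : H) : dot c (a + b) = dot c a + dot c b.
Proof. exact: linearDr. Qed.

Lemma dotNl (a c : H) : dot (- a) c = - dot a c.
Proof. exact: linearNl. Qed.

Lemma dotNr (a c : H) : dot c (- a) = - dot c a.
Proof. exact: linearNr. Qed.

Lemma dotZl (t : R) (a c : H) : dot (t *: a) c = t * dot a c.
Proof. exact: linearZl_LR. Qed.

Lemma dotZr (t : R) (a c : H) : dot c (t *: a) = t * dot c a.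
Proof. exact: linearZr_LR. Qed.

Lemma dot0r (c : H) : dot c 0 = 0.
Proof. exact: linear0r. Qed.

Lemma dot0l (c : H) : dot 0 c = 0.
Proof. exact: linear0l. Qed.

Lemma dot_suml (k : nat) (f : nat -> H) (c : H) :
  dot (\sum_(1 <= l < k.+1) f l) c = \sum_(1 <= l < k.+1) dot (f l) c.
Proof. by rewrite linear_sumlz. Qed.

Definition dotE := (dotDl, dotDr, dotNl, dotNr, dotZl, dotZr).

Lemma dot_ge0 (a : H) : 0 <= dot a a.
Proof.
have [->|a0] := eqVneq a 0; first by rewrite dot0l.
exact/ltW/neq0_dnorm_gt0.
Qed.

Hypothesis hdot : induces_norm dot.

Lemma sqr_normE (a : H) : `|a| ^+ 2 = dot a a.
Proof. by rewrite hdot sqr_sqrtr ?dot_ge0. Qed.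

Lemma cauchy_schwarz (a b : H) : dot a b <= `|a| * `|b|.
Proof.
have [->|b0] := eqVneq b 0; first by rewrite dot0r normr0 mulr0.
have nb : 0 < `|b| by rewrite normr_gt0.
have [a0|a0] := eqVneq a 0; first by rewrite a0 dot0l normr0 mul0r.
have na : 0 < `|a| by rewrite normr_gt0.
have := dot_ge0 (`|b| *: a - `|a| *: b).
rewrite !dotE -!sqr_normE (dotC b a) => h.
have : 0 <= 2 * (`|a| * `|b|) * (`|a| * `|b| - dot a b).
  by apply: (le_trans h); rewrite le_eqVlt; apply/orP; left; apply/eqP; ring.
by rewrite pmulr_rge0 ?subr_ge0 // !mulr_gt0.
Qed.

Lemma parallelogram (a b : H) :
  `|a - b| ^+ 2 = 2 * `|a| ^+ 2 + 2 * `|b| ^+ 2 - `|a + b| ^+ 2 :> R.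
Proof. by rewrite !sqr_normE !dotE; ring. Qed.

Lemma sqr_dist_shift (p q c y : H) :
  `|p - c| ^+ 2 - `|q - c| ^+ 2 =
  `|p - y| ^+ 2 - `|q - y| ^+ 2 + 2 * dot (p - q) (y - c) :> R.
Proof.
by rewrite !sqr_normE !dotE (dotC c p) (dotC c q) (dotC y p) (dotC y q); ring.
Qed.

End InnerProduct.

(** * Orthogonal projection onto a closed subspace *)

Section OrthogonalProjection.
Context {R : realType} {H : completeNormedModType R}.
Context {dot : {dot H for (@idfun R)}}.
Hypothesis hdot : induces_norm dot.

Lemma submod_mem0 (V : set H) : GRing.submod_closed [in V] -> V 0.
Proof. by case=> /[!inE]. Qed.

Lemma submod_memD (V : set H) (t : R) (a b : H) :
  GRing.submod_closed [in V] -> V a -> V b -> V (t *: a + b).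
Proof. by case=> _ hl Va Vb; have := hl t a b; rewrite !inE; apply. Qed.

Lemma orth_compl_submod (V : set H) : GRing.submod_closed [in orth_compl dot V].
Proof.
split=> [|t a b]; rewrite !inE /orth_compl /=; first by move=> v _; exact: dot0r.
by move=> ha hb v Vv; rewrite !dotE ha // hb // mulr0 addr0.
Qed.

(** A sequence in V minimizing the distance to x is Cauchy by the parallelogram
    law; its limit is the nearest point of V, and first order optimality along
    lines in V makes the residual orthogonal to V. *)
Lemma exists_orth_proj (V : set H) (x : H) : closed_subspace V ->
  exists p, V p /\ orth_compl dot V (x - p).
Proof.
move=> [hV cV].
set E : set R := [set `|x - v| ^+ 2 | v in V].
have E0 : E !=set0 by exists (`|x - 0| ^+ 2), 0; rewrite //; exact: submod_mem0.
have Elb : lbound E 0 by move=> _ [v _ <-]; exact: sqr_ge0.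
have hinf : has_inf E by split=> //; exists 0.
have mE v : V v -> inf E <= `|x - v| ^+ 2.
  by move=> Vv; apply: ge_inf; [exists 0 | exists v].
have hv n : exists v, V v /\ `|x - v| ^+ 2 < inf E + n.+1%:R^-1.
  have n0 : (0 : R) < n.+1%:R^-1 by rewrite invr_gt0.
  by have [_ [v Vv <-] hvn] := inf_adherent n0 hinf; exists v.
have [v {}hv] := choice hv.
have vV n : V (v n) by case: (hv n).
have vm n : `|x - v n| ^+ 2 < inf E + n.+1%:R^-1 by case: (hv n).
(* The midpoint of v n and v n' lies in V, hence is no closer to x than the
   infimum allows. *)
have cv n n' : `|v n - v n'| ^+ 2 <= 2 * n.+1%:R^-1 + 2 * n'.+1%:R^-1.
  have Vmid : V (2^-1 *: (v n' + v n)).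
    rewrite -[X in V X]addr0; apply: submod_memD => //; last exact: submod_mem0.
    by rewrite -[X in V (X + _)]scale1r; apply: submod_memD.
  have := mE _ Vmid.
  have -> : x - 2^-1 *: (v n' + v n) = 2^-1 *: ((x - v n') + (x - v n)).
    rewrite addrACA -opprD scalerBr -mulr2n -[x *+ 2]scaler_nat scalerA.
    by rewrite mulVf ?scale1r.
  rewrite normrZ exprMn gtr0_norm ?invr_gt0 //.
  have := parallelogram hdot (x - v n') (x - v n).
  rewrite opprB [_ + (v n - x)]addrC addrA subrK => hp.
  have aux (a b b' c i i' m : R) : c = 2 * b' + 2 * b - a -> b < m + i ->
      b' < m + i' -> m <= 2^-1 ^+ 2 * a -> c <= 2 * i + 2 * i'.
    by rewrite exprVn -natrX => *; lra.
  exact: aux hp (vm n) (vm n').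
have : cvg (v @ \oo).
  apply/cauchy_cvgP/cauchy_exP => e e0.
  have e4 : 0 < e ^+ 2 / 4 by rewrite divr_gt0 ?exprn_gt0.
  have [N _ hN] := near_infty_natSinv_lt (PosNum e4).
  exists (v N), N => //= n /= Nn.
  rewrite -ball_normE /ball_ /= -(@ltr_pXn2r _ 2) ?nnegrE ?normr_ge0 ?(ltW e0) //.
  apply: (le_lt_trans (cv _ _)).
  have aux (i i' s : R) : i < s / 4 -> i' < s / 4 -> 2 * i + 2 * i' < s.
    by move=> *; lra.
  exact: aux (hN N (leqnn N)) (hN n Nn).
move=> /cvg_ex[p vp].
have Vp : V p by apply: (closed_cvg V cV _ p vp); near=> n; exact: vV.
exists p; split=> //.
have pm : `|x - p| ^+ 2 <= inf E.
  have h1 : `|x - v n| ^+ 2 @[n --> \oo] --> `|x - p| ^+ 2.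
    by apply: cvgM; apply: cvg_norm; apply: cvgB => //; exact: cvg_cst.
  have h2 : inf E + (n.+1%:R^-1 : R) @[n --> \oo] --> inf E.
    rewrite -[X in _ --> X]addr0; apply: cvgD; first exact: cvg_cst.
    exact: cvg_harmonic.
  by apply: ler_cvg_to h1 h2 _; near=> n; exact/ltW/vm.
(* t *: w is the projection of x - p onto the line of w: unless t = 0, the point
   t *: w + p of V would be strictly closer to x than p. *)
move=> w Vw; have [->|w0] := eqVneq w 0; first exact: dot0l.
have ww : 0 < dot w w by exact: neq0_dnorm_gt0.
set t := dot w (x - p) / dot w w.
have := le_trans pm (mE _ (submod_memD _ t _ _ hV Vw Vp)).
have -> : x - (t *: w + p) = (x - p) - t *: w by rewrite opprD addrA addrAC.
have : dot w (x - p) = t * dot w w by rewrite /t divfK ?gt_eqF.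
rewrite !(sqr_normE hdot); move: (x - p) => q ht.
rewrite !dotE (dotC q w) ht.
move=> h; have : t ^+ 2 * dot w w <= 0.
  have aux (a c : R) :
      a <= a - t * (t * c) + (- (t * (t * c)) - - (t * (t * c))) ->
      t ^+ 2 * c <= 0 by rewrite expr2; nra.
  apply: aux h.
rewrite pmulr_lle0 // => t2.
have /eqP : t ^+ 2 == 0 by rewrite eq_le t2 sqr_ge0.
by move/eqP; rewrite sqrf_eq0 => /eqP ->; rewrite mul0r.
Unshelve. all: by end_near. Qed.

Lemma orth_projE (V : set H) (x p : H) : GRing.submod_closed [in V] ->
  V p -> orth_compl dot V (x - p) -> orth_proj dot V x = p.
Proof.
move=> hV Vp xp; apply: xget_unique => // q [Vq xq].
apply/eqP; rewrite -subr_eq0; apply/negPn/negP => qp.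
have Vqp : V (q - p) by rewrite addrC -scaleN1r; exact: submod_memD.
have := neq0_dnorm_gt0 (q - p) qp (s := dot).
rewrite -[X in dot _ X](_ : (x - p) - (x - q) = _); last first.
  by rewrite opprB addrC addrA subrK.
by rewrite dotDr dotNr xp // xq // subr0 ltxx.
Qed.

Variable V : set H.
Hypothesis hV : closed_subspace V.
Local Notation P := (orth_proj dot V).

Lemma orth_projP (x : H) : V (P x) /\ orth_compl dot V (x - P x).
Proof. exact: (xgetPex 0 (exists_orth_proj V x hV)). Qed.

Lemma orth_proj_linear (t : R) (a b : H) : P (t *: a + b) = t *: P a + P b.
Proof.
have [Va oa] := orth_projP a; have [Vb ob] := orth_projP b.
apply: orth_projE; [exact: hV.1 | exact: submod_memD hV.1 _ _ |].
rewrite opprD addrACA -scalerBr.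
exact: submod_memD (orth_compl_submod _) _ _.
Qed.

(** V is included in its double orthogonal complement, which suffices to identify
    the projection onto the complement by uniqueness of the decomposition. *)
Lemma orth_proj_compl (x : H) : orth_proj dot (orth_compl dot V) x = x - P x.
Proof.
have [Vx ox] := orth_projP x.
apply: orth_projE => //; first exact: orth_compl_submod.
by rewrite subKr => v hv; rewrite dotC; exact: hv.
Qed.

End OrthogonalProjection.

(** * Ergodic means *)

Section ErgodicMeans.
Context {R : realType} {H : completeNormedModType R}.
Implicit Types (a b : nat -> H) (e : nat -> R) (k : nat).

Lemma ergodic_meanB a b k :
  ergodic_mean (fun l => a l - b l) k = ergodic_mean a k - ergodic_mean b k.
Proof. by rewrite /ergodic_mean sumrB scalerBr. Qed.

Lemma ergodic_mean_cst (z : H) k : (1 <= k)%N -> ergodic_mean (fun=> z) k = z.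
Proof.
move=> k1; rewrite /ergodic_mean sumr_const_nat subSS subn0.
by rewrite -[z *+ k]scaler_nat scalerA mulVf ?scale1r // pnatr_eq0 -lt0n.
Qed.

Lemma ergodic_mean_linear (f : {linear H -> H}) a k :
  f (ergodic_mean a k) = ergodic_mean (fun l => f (a l)) k.
Proof. by rewrite /ergodic_mean linearZ linear_sum. Qed.

Lemma le_norm_ergodic_mean a (B : R) k : (1 <= k)%N ->
  (forall l, (1 <= l <= k)%N -> `|a l| <= B) -> `|ergodic_mean a k| <= B.
Proof.
move=> k1 aB; rewrite /ergodic_mean normrZ ger0_norm ?invr_ge0 //.
rewrite mulrC ler_pdivrMr ?ltr0n //; apply: le_trans (ler_norm_sum _ _ _) _.
have -> : B * k%:R = \sum_(1 <= l < k.+1) B.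
  by rewrite sumr_const_nat subSS subn0 mulr_natr.
by apply: ler_sum_nat => l; exact: aB.
Qed.

Lemma sum_sub_ergodic_mean a k : (1 <= k)%N ->
  \sum_(1 <= l < k.+1) (a l - ergodic_mean a k) = 0.
Proof.
move=> k1; rewrite sumrB sumr_const_nat subSS subn0 /ergodic_mean.
by rewrite -[_ *+ k]scaler_nat scalerA divff ?scale1r ?subrr // pnatr_eq0 -lt0n.
Qed.

Lemma exists_le_mean (f : nat -> R) k : (1 <= k)%N ->
  exists j, (1 <= j <= k)%N /\ k%:R * f j <= \sum_(1 <= l < k.+1) f l.
Proof.
elim: k => // k IHk _.
have [->|k0] := posnP k; first by exists 1%N; rewrite big_nat1 mul1r.
have [j [/andP[j1 jk] hj]] := IHk k0.
rewrite big_nat_recr //= -natr1.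
have [fj|fj] := leP (f j) (f k.+1); [exists j | exists k.+1].
  split; first by rewrite j1 leqW.
  by rewrite mulrDl mul1r lerD.
split; first by rewrite !ltnS leqnn.
rewrite mulrDl mul1r lerD // (le_trans _ hj) //.
by rewrite ler_wpM2l // ltW.
Qed.

Context {dot : {dot H for (@idfun R)}}.

(** The parallel axis identity: moving the base point of the mean pairing from the
    pair of means to (p, q) costs the pairing of the two displacements, the cross
    terms vanishing because deviations from a mean sum to zero.  Base points in
    the graph of T give the transportation formula; q = 0 and p the mean of a
    rewrite the ergodic error without the mean of b. *)
Lemma ergodic_epsE a b e k (p q : H) : (1 <= k)%N ->
  ergodic_eps dot a b e k + dot (ergodic_mean a k - p) (ergodic_mean b k - q) =
  k%:R^-1 * \sum_(1 <= l < k.+1) (e l + dot (a l - p) (b l - q)).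
Proof.
move=> k1; set A := ergodic_mean a k; set B := ergodic_mean b k.
have k0 : k%:R != 0 :> R by rewrite pnatr_eq0 -lt0n.
have split_dot l : e l + dot (a l - p) (b l - q) =
    (e l + dot (a l - A) (b l - B)) + dot (A - p) (B - q)
    + (dot (a l - A) (B - q) + dot (b l - B) (A - p)).
  rewrite -(subrK A (a l)) -(subrK B (b l)) !addrK -!(addrA _ A) -!(addrA _ B).
  rewrite !(dotDl (_ - A)) !(dotDr (_ - B)) (dotC (A - p) (b l - B)); ring.
under eq_bigr do rewrite split_dot.
rewrite big_split /= [X in _ * (_ + X)]big_split /= -!(@dot_suml _ _ dot).
rewrite !sum_sub_ergodic_mean // !dot0l !addr0 big_split /= mulrDr; congr +%R.
by rewrite sumr_const_nat subSS subn0 -[X in _ * X]mulr_natl mulKf.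
Qed.

End ErgodicMeans.

(** * Hybrid proximal extragradient sequences *)

Definition hpe_sequence {R : realType} {H : completeNormedModType R}
    (sigma : R) (x w v : nat -> H) (eps : nat -> R) : Prop :=
  forall k, (1 <= k)%N ->
    [/\ 0 <= eps k,
        `|v k + w k - x k.-1| ^+ 2 + 2 * eps k
          <= sigma ^+ 2 * `|w k - x k.-1| ^+ 2
      & x k = x k.-1 - v k].

(** For v l in the (eps l)-enlargement of a monotone operator at w l, this holds
    at every zero z of the operator.  It is all that the convergence analysis
    uses about zeros, so the operator itself does not appear. *)
Definition weak_zero {R : realType} {H : completeNormedModType R}
    (dot : {dot H for (@idfun R)}) (w v : nat -> H) (eps : nat -> R) (z : H) :
    Prop :=
  forall k, (1 <= k)%N -> 0 <= eps k + dot (w k - z) (v k).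

Section HybridProximalExtragradient.
Context {R : realType} {H : completeNormedModType R}.
Context {dot : {dot H for (@idfun R)}}.
Hypothesis hdot : induces_norm dot.
Context {sigma : R} {x w v : nat -> H} {eps : nat -> R}.
Hypothesis hsigma : 0 <= sigma < 1.

Hypothesis hpe : hpe_sequence sigma x w v eps.

(** Expanding |x' - z|^2 with x' = x - v gives
    |x - z|^2 - |x' - z|^2 = 2 <w - z, v> + |w - x|^2 - |v + w - x|^2, and the
    error criterion bounds the last term. *)
Lemma hpe_step k (z : H) : (1 <= k)%N ->
  2 * (eps k + dot (w k - z) (v k)) + (1 - sigma ^+ 2) * `|w k - x k.-1| ^+ 2
    <= `|x k.-1 - z| ^+ 2 - `|x k - z| ^+ 2.
Proof.
move=> /hpe[_ herr ->]; move: (x k.-1) (w k) (v k) (eps k) herr => y w' v' e herr.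
have -> : `|y - z| ^+ 2 - `|y - v' - z| ^+ 2 =
    2 * dot (w' - z) v' + `|w' - y| ^+ 2 - `|v' + w' - y| ^+ 2.
  rewrite !(sqr_normE hdot) !dotE.
  rewrite (dotC v' y) (dotC v' w') (dotC z y) (dotC z v') (dotC w' y); ring.
move: herr; move: (dot _ _) (`|_| ^+ 2) (`|_| ^+ 2) => a b c; lra.
Qed.

Lemma hpe_telescope k (z : H) :
  \sum_(1 <= l < k.+1) (2 * (eps l + dot (w l - z) (v l))
      + (1 - sigma ^+ 2) * `|w l - x l.-1| ^+ 2)
    <= `|x 0%N - z| ^+ 2 - `|x k - z| ^+ 2.
Proof.
elim: k => [|k IHk]; first by rewrite big_geq // subrr.
rewrite big_nat_recr //=.
by apply: le_trans (lerD IHk (hpe_step k.+1 z isT)) _; rewrite /= subrKA.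
Qed.

Let sigma2_gt0 : 0 < 1 - sigma ^+ 2.
Proof. by case/andP: hsigma => *; nra. Qed.

Lemma hpe_gap_sum k (z : H) :
  2 * \sum_(1 <= l < k.+1) (eps l + dot (w l - z) (v l))
    <= `|x 0%N - z| ^+ 2 - `|x k - z| ^+ 2.
Proof.
apply: le_trans (hpe_telescope k z); rewrite mulr_sumr ler_sum // => l _.
by rewrite lerDl mulr_ge0 ?sqr_ge0 // ltW.
Qed.

Lemma hpe_fejer k (z : H) : weak_zero dot w v eps z ->
  (1 - sigma ^+ 2) * (\sum_(1 <= l < k.+1) `|w l - x l.-1| ^+ 2)
    + `|x k - z| ^+ 2 <= `|x 0%N - z| ^+ 2.
Proof.
move=> hz; rewrite -lerBrDr; apply: le_trans (hpe_telescope k z).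
rewrite mulr_sumr; apply: ler_sum_nat => l /andP[l1 _].
by rewrite lerDr mulr_ge0 // hz.
Qed.

Lemma hpe_sum_le k (z : H) : weak_zero dot w v eps z ->
  (1 - sigma ^+ 2) * (\sum_(1 <= l < k.+1) `|w l - x l.-1| ^+ 2)
    <= `|x 0%N - z| ^+ 2.
Proof. by move=> /(hpe_fejer k); apply: le_trans; rewrite lerDl sqr_ge0. Qed.

Lemma hpe_dist_le k (z : H) : weak_zero dot w v eps z ->
  `|x k - z| <= `|x 0%N - z|.
Proof.
move=> /(hpe_fejer k) h; rewrite -(@ler_pXn2r _ 2) ?nnegrE ?normr_ge0 //.
apply: le_trans h; rewrite lerDr mulr_ge0 ?(ltW sigma2_gt0) //.
by apply: sumr_ge0 => l _; exact: sqr_ge0.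
Qed.

Lemma hpe_travel_le k (z : H) : weak_zero dot w v eps z ->
  `|x 0%N - x k| <= 2 * `|x 0%N - z|.
Proof.
move=> /(hpe_dist_le k) h; rewrite -(subrKA z).
rewrite (le_trans (ler_normD _ _)) // (distrC z).
by rewrite mulr_natl mulr2n lerD.
Qed.

Lemma hpe_residual_le k : (1 <= k)%N ->
  `|v k + w k - x k.-1| <= sigma * `|w k - x k.-1|.
Proof.
case/andP: hsigma => s0 _ /hpe[e0 h _].
rewrite -(@ler_pXn2r _ 2) ?nnegrE ?mulr_ge0 ?normr_ge0 // exprMn.
by apply: le_trans h; rewrite lerDl mulr_ge0.
Qed.

(** With wa the mean of the w l, 2 k times the ergodic error is at most
    |x 0 - wa|^2 - |x k - wa|^2.  Bounding this by |x 0 - wa|^2 would put the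
    distance of w l to x l inside the square.  Recentering at the mean y of the
    x l instead leaves a difference of at most |x 0 - y|^2 <= (2 D)^2, with
    D = |x 0 - z|, plus 2 <x 0 - x k, y - wa>; since y - wa is the mean of the
    x l - w l, whose norms are at most sigma D / sqrt (1 - sigma^2), this last term
    is at most 4 sigma D^2 / sqrt (1 - sigma^2). *)
Lemma hpe_ergodic_eps_le k (z : H) : (1 <= k)%N -> weak_zero dot w v eps z ->
  k%:R * ergodic_eps dot w v eps k
    <= 2 * (1 + sigma / Num.sqrt (1 - sigma ^+ 2)) * `|x 0%N - z| ^+ 2.
Proof.
move=> k1 hz; set D := `|x 0%N - z|; set s := Num.sqrt _.
have s0 : 0 < s by rewrite sqrtr_gt0.
have D0 : 0 <= D by exact: normr_ge0.
have sig0 : 0 <= sigma by case/andP: hsigma.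
have k0 : k%:R != 0 :> R by rewrite pnatr_eq0 -lt0n.
set wa := ergodic_mean w k; set y := ergodic_mean x k.
have h1 : 2 * (k%:R * ergodic_eps dot w v eps k)
    <= `|x 0%N - wa| ^+ 2 - `|x k - wa| ^+ 2.
  have := @ergodic_epsE _ _ dot w v eps k wa 0 k1.
  rewrite subrr dot0l addr0 => ->; rewrite mulVKf //.
  under eq_bigr do rewrite subr0.
  exact: hpe_gap_sum.
have h2 := sqr_dist_shift hdot (x 0%N) (x k) wa y.
have yz : `|y - z| <= D.
  rewrite -(ergodic_mean_cst z k k1) -ergodic_meanB.
  by apply: le_norm_ergodic_mean => // l _; exact: hpe_dist_le.
have xy : `|x 0%N - y| <= 2 * D.
  rewrite -(subrKA z) (le_trans (ler_normD _ _)) // (distrC z).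
  by rewrite mulr_natl mulr2n lerD.
have ywa : `|y - wa| <= sigma * (D / s).
  rewrite -ergodic_meanB; apply: le_norm_ergodic_mean => // l /andP[l1 _].
  have [_ _ xl] := hpe l l1.
  have -> : x l - w l = - (v l + w l - x l.-1).
    by rewrite xl opprB opprD addrA.
  rewrite normrN (le_trans (hpe_residual_le l l1)) // ler_wpM2l // ler_pdivlMr //.
  rewrite -(@ler_pXn2r _ 2) ?nnegrE ?mulr_ge0 ?normr_ge0 ?(ltW s0) //.
  rewrite exprMn sqr_sqrtr ?(ltW sigma2_gt0) // mulrC.
  have := hpe_dist_le l.-1 z hz; rewrite -/D => hD.
  have := hpe_step l z l1; have := hz l l1.
  have : `|x l.-1 - z| ^+ 2 <= D ^+ 2 by rewrite ler_pXn2r ?nnegrE ?normr_ge0.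
  have := sqr_ge0 `|x l - z|.
  move: (`|x l.-1 - z| ^+ 2) (`|x l - z| ^+ 2) (_ * `|_| ^+ 2) (eps l + _)
    (D ^+ 2).
  move=> a b c e f; lra.
have xk := hpe_travel_le k z hz.
have cs := cauchy_schwarz hdot (x 0%N - x k) (y - wa).
have cs2 : dot (x 0%N - x k) (y - wa) <= 2 * D * (sigma * (D / s)).
  by apply: le_trans cs _; rewrite ler_pM ?normr_ge0.
have hxy : `|x 0%N - y| ^+ 2 <= (2 * D) ^+ 2.
  by rewrite ler_pXn2r ?nnegrE ?normr_ge0 ?mulr_ge0.
have := sqr_ge0 `|x k - y|; move: h1 cs2 hxy; rewrite h2.
have -> : 2 * (1 + sigma / s) * D ^+ 2 =
    2^-1 * (2 * D) ^+ 2 + 2 * D * (sigma * (D / s)).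
  by field; rewrite gt_eqF.
move: (_ ^+ 2) (_ ^+ 2) (dot _ _) (_ ^+ 2) (_ * (sigma * _))
  (_ * ergodic_eps _ _ _ _ _).
move=> a b c e f g; lra.
Qed.
End HybridProximalExtragradient.

(** * Enlargements of monotone operators *)

Section EnlargementFacts.
Context {R : realType} {H : completeNormedModType R}.
Context {dot : {dot H for (@idfun R)}}.

(** If e < 0 then (x, v) is monotonically related to the graph of T, so it can be
    added to it; by maximality it already belongs to the graph, and testing the
    enlargement inequality at (x, v) itself gives - e <= 0. *)
Lemma enlargement_ge0 (T : H -> set H) (e : R) (x v : H) :
  maximal_monotone dot T -> enlargement dot T e x v -> 0 <= e.
Proof.
move=> [mT maxT] hxv; rewrite leNgt; apply/negP => e0.
pose S y : set H := [set w | T y w \/ (y = x /\ w = v)].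
have mS : monotone_op dot S.
  move=> y y' w w' [yw|[-> ->]] [yw'|[-> ->]]; first exact: mT yw yw'.
  - rewrite -(opprB w) -(opprB y) dotNl dotNr opprK.
    by apply: le_trans (hxv _ _ yw); rewrite oppr_ge0 ltW.
  - by apply: le_trans (hxv _ _ yw'); rewrite oppr_ge0 ltW.
  - by rewrite subrr dot0l.
have TS : graph T `<=` graph S by move=> yw; left.
have : graph S (x, v) by right.
rewrite (maxT S mS TS) => /hxv; rewrite subrr dot0l.
by rewrite oppr_le0 leNgt e0.
Qed.

(** The transportation formula: by [ergodic_epsE], the inequality for the means
    at a point of the graph of T is the average of the inequalities for the
    individual terms. *)
Lemma enlargement_ergodic (T : H -> set H) (a b : nat -> H) (e : nat -> R) k :
  (1 <= k)%N ->
  (forall l, (1 <= l <= k)%N -> enlargement dot T (e l) (a l) (b l)) ->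
  enlargement dot T (ergodic_eps dot a b e k) (ergodic_mean a k)
    (ergodic_mean b k).
Proof.
move=> k1 hT x' v' Tx'; rewrite -(opprB (ergodic_mean b k)).
rewrite -(opprB (ergodic_mean a k)) dotNl dotNr opprK (dotC (_ - v')).
rewrite -subr_ge0 opprK addrC ergodic_epsE // mulr_ge0 ?invr_ge0 //.
rewrite big_nat; apply: sumr_ge0 => l /andP[l1 lk].
have := hT l; rewrite l1 -ltnS => /(_ lk) /(_ _ _ Tx').
rewrite -(opprB (b l)) -(opprB (a l)) dotNl dotNr opprK dotC.
by rewrite -subr_ge0 opprK addrC.
Qed.

End EnlargementFacts.

(** * Distance to a set *)

Section DistanceToSet.
Context {R : realType} {H : completeNormedModType R}.
Implicit Types (S : set H) (x : H).

Lemma dist_to_ge0 x S : S !=set0 -> 0 <= dist_to x S.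
Proof.
move=> [z Sz]; apply: lb_le_inf; first by exists `|x - z|, z.
by move=> _ [y _ <-]; exact: normr_ge0.
Qed.

Lemma le_sqr_dist_to x S (a c : R) : S !=set0 -> 0 < c ->
  (forall z, S z -> a <= c * `|x - z| ^+ 2) -> a <= c * dist_to x S ^+ 2.
Proof.
move=> S0 c0 h; have [z0 Sz0] := S0.
have hs : Num.sqrt (a / c) <= dist_to x S.
  apply: lb_le_inf; first by exists `|x - z0|, z0.
  move=> _ [z Sz <-]; rewrite -[leRHS]ger0_norm ?normr_ge0 // -sqrtr_sqr.
  by rewrite ler_wsqrtr // ler_pdivrMr // mulrC h.
have [a0|a0] := leP a 0.
  by apply: le_trans a0 _; rewrite mulr_ge0 ?sqr_ge0 // ltW.
rewrite mulrC -ler_pdivrMr // -[leLHS]sqr_sqrtr ?divr_ge0 ?(ltW a0) ?(ltW c0) //.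
by rewrite ler_pXn2r ?nnegrE ?sqrtr_ge0 // dist_to_ge0.
Qed.

End DistanceToSet.

(** * Spingarn's exchange of components *)

Section PartialInverse.
Context {R : realType} {H : completeNormedModType R}.
Context {dot : {dot H for (@idfun R)}}.
Variable P : {linear H -> H}.
Hypothesis P_orth : forall a b, dot (P a) (b - P b) = 0.

(** The first component of Spingarn's exchange; the second one is
    [partial_swap b a]. *)
Definition partial_swap (a b : H) : H := P a + (b - P b).

Lemma partial_swapB a b a' b' :
  partial_swap a b - partial_swap a' b' = partial_swap (a - a') (b - b').
Proof.
rewrite /partial_swap !linearB /= opprD addrACA; congr (_ + _).
by rewrite opprD addrACA -opprD.
Qed.

Lemma dot_partial_swap a b : dot (partial_swap a b) (partial_swap b a) = dot a b.
Proof.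
rewrite /partial_swap -[in RHS](subrKC (P a) a) -[in RHS](subrKC (P b) b).
rewrite !(dotDl (P _)) !(dotDr (P _)) !P_orth.
by rewrite !(dotC (_ - _) (P _)) !P_orth (dotC (b - P b)) !addr0 !add0r.
Qed.

Lemma partial_swap_mean (a b : nat -> H) k :
  partial_swap (ergodic_mean a k) (ergodic_mean b k) =
  ergodic_mean (fun l => partial_swap (a l) (b l)) k.
Proof.
rewrite /partial_swap !(ergodic_mean_linear P) -ergodic_meanB /ergodic_mean.
by rewrite -scalerDr -big_split.
Qed.

Lemma ergodic_eps_partial_swap (a b : nat -> H) (e : nat -> R) k :
  ergodic_eps dot (fun l => partial_swap (a l) (b l))
    (fun l => partial_swap (b l) (a l)) e k = ergodic_eps dot a b e k.
Proof.
rewrite /ergodic_eps; congr (_ * _); apply: eq_bigr => l _.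
by rewrite -!partial_swap_mean !partial_swapB dot_partial_swap.
Qed.

End PartialInverse.

(** * Complexity of hybrid proximal extragradient sequences *)

Section HPEComplexity.
Context {R : realType} {H : completeNormedModType R}.
Context {dot : {dot H for (@idfun R)}}.
Hypothesis hdot : induces_norm dot.
Variables (sigma : R) (x w v : nat -> H) (eps : nat -> R) (S : set H).
Hypotheses (hsigma : 0 <= sigma < 1) (hpe : hpe_sequence sigma x w v eps).
Hypotheses (S0 : S !=set0)
  (hS : forall z, S z -> weak_zero dot w v eps z).
Local Notation d := (dist_to (x 0%N) S).

Let d_ge0 : 0 <= d. Proof. exact: dist_to_ge0. Qed.

(** Take for j the index with the smallest |w j - x j.-1|, which does not depend
    on any zero.  Its square is at most d^2 / ((1 - sigma^2) k), and
    (1 + sigma)^2 / (1 - sigma^2) = (1 + sigma) / (1 - sigma). *)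
Lemma hpe_pointwise k : (1 <= k)%N ->
  exists j, (1 <= j <= k)%N /\
    (`|v j| <= d / Num.sqrt k%:R * Num.sqrt ((1 + sigma) / (1 - sigma)) /\
     eps j <= sigma ^+ 2 * d ^+ 2 / (2 * (1 - sigma ^+ 2) * k%:R)).
Proof.
move=> k1; have /andP[s0 s1] := hsigma.
have k0 : 0 < k%:R :> R by rewrite ltr0n.
have c0 : 0 < 1 - sigma ^+ 2 by nra.
have [j [hj hmin]] := exists_le_mean (fun l => `|w l - x l.-1| ^+ 2) k k1.
exists j; split=> //; have /andP[j1 _] := hj.
set r := `|w j - x j.-1| in hmin.
have hr : r ^+ 2 <= d ^+ 2 / ((1 - sigma ^+ 2) * k%:R).
  rewrite ler_pdivlMr ?mulr_gt0 // mulrC -mulrA -[leRHS]mul1r.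
  apply: le_sqr_dist_to => // z Sz; rewrite mul1r.
  have hsum := hpe_sum_le hdot hpe k z (hS _ Sz).
 apply: le_trans hsum.
  by rewrite ler_pM2l.
have hres := hpe_residual_le hsigma hpe j j1; rewrite -/r in hres.
split.
  have hv : `|v j| <= (1 + sigma) * r.
    have -> : v j = (v j + w j - x j.-1) - (w j - x j.-1).
      by rewrite -(addrA (v j)) addrK.
    rewrite (le_trans (ler_normB _ _)) // -/r mulrDl mul1r addrC.
    by rewrite lerD2l.
  rewrite -(@ler_pXn2r _ 2) ?nnegrE ?mulr_ge0 ?invr_ge0 ?sqrtr_ge0 //.
  rewrite 2!exprMn exprVn !sqr_sqrtr ?divr_ge0 ?subr_ge0 ?(ltW s1) ?addr_ge0 //.
  have hv2 : `|v j| ^+ 2 <= (1 + sigma) ^+ 2 * r ^+ 2.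
    by rewrite -exprMn ler_pXn2r ?nnegrE ?normr_ge0 // (le_trans _ hv).
  apply: le_trans hv2 _.
  have -> : d ^+ 2 / k%:R * ((1 + sigma) / (1 - sigma)) =
      (1 + sigma) ^+ 2 * (d ^+ 2 / ((1 - sigma ^+ 2) * k%:R)).
    have s1' : 1 - sigma != 0 by rewrite subr_eq0 gt_eqF.
    by field; rewrite s1' !gt_eqF.
  by rewrite ler_wpM2l ?sqr_ge0.
have [_ he _] := hpe j j1; rewrite -/r in he.
have -> : sigma ^+ 2 * d ^+ 2 / (2 * (1 - sigma ^+ 2) * k%:R) =
    2^-1 * (sigma ^+ 2 * (d ^+ 2 / ((1 - sigma ^+ 2) * k%:R))).
  by field; rewrite !gt_eqF.
have : sigma ^+ 2 * r ^+ 2 <= sigma ^+ 2 * (d ^+ 2 / ((1 - sigma ^+ 2) * k%:R)).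
  by rewrite ler_wpM2l ?sqr_ge0.
have := sqr_ge0 `|v j + w j - x j.-1|; move: he.
move: (`|_| ^+ 2) (_ * r ^+ 2) (_ * (_ / _)) (eps j) => a b c e; lra.
Qed.

(** The updates telescope: k times the mean of the v l is x 0 - x k. *)
Lemma hpe_ergodic k : (1 <= k)%N ->
  `|ergodic_mean v k| <= 2 * d / k%:R /\
  ergodic_eps dot w v eps k
    <= 2 * (1 + sigma / Num.sqrt (1 - sigma ^+ 2)) * d ^+ 2 / k%:R.
Proof.
move=> k1; have /andP[s0 s1] := hsigma.
have k0 : 0 < k%:R :> R by rewrite ltr0n.
split; rewrite ler_pdivlMr //; last first.
  rewrite mulrC; apply: le_sqr_dist_to => // [|z Sz].
    by rewrite mulr_gt0 // ltr_pwDl // divr_ge0 ?sqrtr_ge0.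
  exact: (hpe_ergodic_eps_le hdot hsigma hpe k z k1 (hS _ Sz)).
have -> : `|ergodic_mean v k| * k%:R = `|x 0%N - x k|.
  rewrite /ergodic_mean normrZ ger0_norm ?invr_ge0 // mulrC mulVKf ?gt_eqF //.
  congr `|_|; rewrite -[RHS]opprB -telescope_sumr // big_add1 /= -sumrN.
  apply: eq_bigr => l _; have [_ _ ->] := hpe l.+1 isT.
  by rewrite opprB /= subKr.
rewrite -(@ler_pXn2r _ 2) ?nnegrE ?mulr_ge0 ?normr_ge0 // exprMn.
apply: le_sqr_dist_to => // z Sz.
rewrite -exprMn ler_pXn2r ?nnegrE ?mulr_ge0 ?normr_ge0 //.
exact: (hpe_travel_le hdot hsigma hpe k z (hS _ Sz)).
Qed.

End HPEComplexity.

(** * The inexact partial inverse method *)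

Theorem theorem3p1 (R : realType) (H : completeNormedModType R)
    (dot : {dot H for (@idfun R)}) (hdot : induces_norm dot)
    (T : H -> set H) (hT : maximal_monotone dot T)
    (V : set H) (hV : closed_subspace V)
    (hS : solution_set dot V T !=set0)
    (x0 : H) (sigma : R) (hsigma : 0 <= sigma < 1)
    (x xt u : nat -> H) (eps : nat -> R)
    (halg : inexact_partial_inverse dot V T x0 sigma x xt u eps) :
  let PV := orth_proj dot V in
  let PVc := orth_proj dot (orth_compl dot V) in
  let d := dist_to x0 (solution_set dot V T) in
  let xa := ergodic_mean xt in
  let ua := ergodic_mean u in
  let epsa := ergodic_eps dot xt u eps in
  (forall k : nat, (1 <= k)%N ->
     exists j : nat, (1 <= j <= k)%N /\
       [/\ enlargement dot T (eps j) (xt j) (u j),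
           Num.sqrt (`|xt j - PV (xt j)| ^+ 2 + `|u j - PVc (u j)| ^+ 2)
             <= d / Num.sqrt k%:R * Num.sqrt ((1 + sigma) / (1 - sigma))
         & eps j <= sigma ^+ 2 * d ^+ 2 / (2 * (1 - sigma ^+ 2) * k%:R)]) /\
  (forall k : nat, (1 <= k)%N ->
     [/\ enlargement dot T (epsa k) (xa k) (ua k),
         Num.sqrt (`|xa k - PV (xa k)| ^+ 2 + `|ua k - PVc (ua k)| ^+ 2)
           <= 2 * d / k%:R
       & 0 <= epsa k
           <= 2 * (1 + sigma / Num.sqrt (1 - sigma ^+ 2)) * d ^+ 2 / k%:R]).
Proof.
move=> PV PVc d xa ua epsa; have [x00 hstep] := halg.
pose P : {linear H -> H} := HB.pack_for {linear H -> H} (orth_proj dot V)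
  (GRing.isLinear.Build R H H *:%R (orth_proj dot V)
    (orth_proj_linear hdot V hV)).
have PE a : PV a = P a by [].
have PcE a : PVc a = a - P a by rewrite -PE; exact: orth_proj_compl.
have P_orth a b : dot (P a) (b - P b) = 0.
  by have [_] := orth_projP hdot V hV b; apply; case: (orth_projP hdot V hV a).
pose w l := partial_swap P (xt l) (u l); pose v l := partial_swap P (u l) (xt l).
have hpe : hpe_sequence sigma x w v eps.
  move=> l l1; have [e0 _ herr xl] := hstep l l1; split=> //.
    move: herr; rewrite -/PV -/PVc !PcE !PE -/(partial_swap P _ _).
    suff -> : u l + xt l = v l + w l by [].
    by rewrite /v /w /partial_swap [P (xt l) + _]addrC addrACA !subrKC subrK.
  by rewrite xl -/PV -/PVc !PcE !PE.
have zeros z : solution_set dot V T z -> weak_zero dot w v eps z.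
  move=> [y [q [Vy oq Tyq ->]]] l l1.
  have Py : P y = y.
    by apply: (orth_projE V y y hV.1) => // a _; rewrite subrr dot0r.
  have Pq : P q = 0.
    by apply: (orth_projE V q 0 hV.1); rewrite ?subr0 //;
      exact: (submod_mem0 V hV.1).
  have -> : y + q = partial_swap P y q by rewrite /partial_swap Py Pq subr0.
  have -> : v l = v l - partial_swap P q y.
    by rewrite /partial_swap Py Pq add0r !subrr subr0.
  rewrite !partial_swapB dot_partial_swap //.
  have [_ hen _ _] := hstep l l1.
  have := hen _ _ Tyq.
  rewrite -(opprB (u l)) -(opprB (xt l)) dotNl dotNr opprK dotC.
  by rewrite -subr_ge0 opprK addrC.
have residual a b :
    `|a - PV a| ^+ 2 + `|b - PVc b| ^+ 2 = `|partial_swap P b a| ^+ 2.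
  rewrite PcE PE subKr /partial_swap; have := P_orth b a.
  move: (P b) (a - P a) => p q pq; rewrite !(sqr_normE hdot) !dotDl !dotDr.
  by rewrite (dotC q p) pq addr0 add0r addrC.
rewrite /d -x00; split=> k k1.
  have [j [hj [hvj hej]]] :=
    hpe_pointwise hdot _ _ _ _ _ _ hsigma hpe hS zeros k k1.
  exists j; split=> //; have /andP[j1 _] := hj.
  by split=> //; [case: (hstep j j1) | rewrite residual sqrtr_sqr normr_id].
have [hva hea] := hpe_ergodic hdot _ _ _ _ _ _ hsigma hpe hS zeros k k1.
have hen : enlargement dot T (epsa k) (xa k) (ua k).
  by apply: enlargement_ergodic => // l /andP[l1 _]; case: (hstep l l1).
split=> //.
  by rewrite residual sqrtr_sqr normr_id (partial_swap_mean P).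
rewrite (enlargement_ge0 _ _ _ _ hT hen) /=.
by rewrite /epsa -(ergodic_eps_partial_swap P P_orth).
Qed.
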